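(* Let $L$ be an $n$-dimensional non-abelian nilpotent Lie algebra over a field $\mathbb{F}$ with derived subalgebra of dimension $m$. Then $$\dim \otimes^{3}L\le n(n-m)^{2}.$$ In particular, for $m=1$ the equality $\dim\otimes^{3}L=n(n-1)^{2}$ holds if and only if $L\cong H(1)$.
   Context: $\mathbb{F}$ is a fixed field and all Lie algebras are over $\mathbb{F}$. $H(1)=\langle x,y,z\mid [x,y]=z\rangle$ is the $3$-dimensional Heisenberg Lie algebra. An action of a Lie algebra $L$ on a Lie algebra $K$ is an $\mathbb{F}$-bilinear map $L\times K\to K$, $(l,k)\mapsto {}^{l}k$, with ${}^{[l,l']}k={}^{l}({}^{l'}k)-{}^{l'}({}^{l}k)$ and ${}^{l}[k,k']=[{}^{l}k,k']+[k,{}^{l}k']$. If $L$ and $K$ act on each other, the actions are compatible if ${}^{({}^{l}k)}l'=[l',{}^{k}l]$ and ${}^{({}^{k}l)}k'=[k',{}^{l}k]$ for all $l,l'\in L$, $k,k'\in K$. Given compatible actions (each Lie algebra acting on itself by ${}^{l'}l=[l',l]$), the non-abelian tensor product $L\otimes K$ is the Lie algebra generated by symbols $l\otimes k$ ($l\in L$, $k\in K$) subject to: $c(l\otimes k)=cl\otimes k=l\otimes ck$ for $c\in\mathbb{F}$; $(l+l')\otimes k=l\otimes k+l'\otimes k$; $l\otimes(k+k')=l\otimes k+l\otimes k'$; $[l,l']\otimes k=l\otimes {}^{l'}k-l'\otimes {}^{l}k$; $l\otimes[k,k']={}^{k'}l\otimes k-{}^{k}l\otimes k'$; $[l\otimes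 k,\,l'\otimes k']=-\,{}^{k}l\otimes {}^{l'}k'$. $L\otimes L$ is the tensor square, with all actions given by Lie multiplication. $L$ acts on $L\otimes L$ by ${}^{x}(a\otimes b)=[x,a]\otimes b+a\otimes[x,b]$, and $L\otimes L$ acts on $L$ by ${}^{t}l=[\lambda(t),l]$, where $\lambda:L\otimes L\to L$ is the homomorphism $a\otimes b\mapsto[a,b]$. These actions are compatible, and the triple tensor product is $\otimes^{3}L=(L\otimes L)\otimes L$ formed with these actions. *)

(* Defs.v *)
From HB Require Import structures.
From mathcomp Require Import all_boot all_order all_algebra.
From mathcomp Require Import boolp.

Set Implicit Arguments.
Unset Strict Implicit.
Unset Printing Implicit Defensive.

Import GRing.Theory.
Local Open Scope ring_scope.
Local Open Scope quotient_scope.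

Reserved Notation "[< x , y >]" (at level 0, format "[<  x ,  y  >]").

(* The bracket is alternating, not merely antisymmetric, so that F may have   *)
(* characteristic 2.                                                          *)
HB.mixin Record Lmodule_isLie (F : fieldType) L of GRing.Lmodule F L := {
  lie_br : L -> L -> L;
  lie_brDl : forall x y z, lie_br (x + y) z = lie_br x z + lie_br y z;
  lie_brDr : forall x y z, lie_br x (y + z) = lie_br x y + lie_br x z;
  lie_brZl : forall a x y, lie_br (a *: x) y = a *: lie_br x y;
  lie_brZr : forall a x y, lie_br x (a *: y) = a *: lie_br x y;
  lie_brxx : forall x, lie_br x x = 0;
  lie_jacobi : forall x y z,
    lie_br x (lie_br y z) + lie_br y (lie_br z x) + lie_br z (lie_br x y) = 0
}.

#[short(type="lieAlgType")]
HB.structure Definition LieAlgebra (F : fieldType) :=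
  { L of Lmodule_isLie F L & GRing.Lmodule F L }.

#[short(type="vectLieAlgType")]
HB.structure Definition VectLieAlgebra (F : fieldType) :=
  { L of LieAlgebra F L & Vector F L }.

Notation "[< x , y >]" := (lie_br x y) : ring_scope.

Section LieTheory.
Variables (F : fieldType) (L : lieAlgType F).
Implicit Types x y z : L.

Lemma lie_br0l x : [< 0, x >] = 0.
Proof. by have := lie_brZl 0 0 x; rewrite !scale0r. Qed.

Lemma lie_br0r x : [< x, 0 >] = 0.
Proof. by have := lie_brZr 0 x 0; rewrite !scale0r. Qed.

Lemma lie_brNl x y : [< - x, y >] = - [< x, y >].
Proof. by rewrite -scaleN1r lie_brZl scaleN1r. Qed.

Lemma lie_brNr x y : [< x, - y >] = - [< x, y >].
Proof. by rewrite -scaleN1r lie_brZr scaleN1r. Qed.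

Lemma lie_brC x y : [< x, y >] = - [< y, x >].
Proof.
apply/eqP; rewrite -addr_eq0; apply/eqP.
have := lie_brxx (x + y).
by rewrite lie_brDl !lie_brDr !lie_brxx add0r addr0.
Qed.

Lemma lie_br_deriv x y z :
  [< x, [< y, z >] >] = [< [< x, y >], z >] + [< y, [< x, z >] >].
Proof.
have /eqP := lie_jacobi x y z; rewrite -addrA addr_eq0 => /eqP ->.
by rewrite opprD (lie_brC z x) lie_brNr opprK addrC -lie_brC.
Qed.

Lemma lie_br_brl x y z :
  [< [< x, y >], z >] = [< x, [< y, z >] >] - [< y, [< x, z >] >].
Proof. by rewrite [in RHS]lie_br_deriv addrK. Qed.

End LieTheory.

Definition lie_hom (F : fieldType) (L M : lieAlgType F) (f : L -> M) : Prop :=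
  linear f /\ forall x y, f [< x, y >] = [< f x, f y >].

Definition lie_isom (F : fieldType) (L M : lieAlgType F) : Prop :=
  exists2 f : L -> M, lie_hom f & bijective f.

Definition lie_abelian (F : fieldType) (L : lieAlgType F) : Prop :=
  forall x y : L, [< x, y >] = 0.

(* [has_dim V d]: V is finite dimensional, of dimension d.  This is the       *)
(* library's [Vector.axiom d V] as a proposition; it applies to modules, like *)
(* the tensor products below, that are not known to be of finite dimension.   *)
Definition has_dim (F : fieldType) (V : lmodType F) (d : nat) : Prop :=
  inhabited (Vector.axiom d V).

Section LowerCentral.
Variables (F : fieldType) (L : vectLieAlgType F).
Implicit Types U V W : {vspace L}.

(* Same encoding as the product [prodv] of subspaces of an algebra.           *)
Definition lie_brv U V : {vspace L} :=
  <<[seq [< x, y >] | x <- vbasis U, y <- vbasis V]>>%VS.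

Lemma memv_lie_br U V x y : x \in U -> y \in V -> [< x, y >] \in lie_brv U V.
Proof.
move=> /coord_vbasis-> /coord_vbasis->.
elim/big_rec: _ => [|i u _ IH]; first by rewrite lie_br0l mem0v.
rewrite lie_brDl memvD // lie_brZl memvZ //.
elim/big_rec: _ => [|j v _ IH']; first by rewrite lie_br0r mem0v.
rewrite lie_brDr memvD // lie_brZr memvZ // memv_span //.
by apply/allpairsP; exists ((vbasis U)`_i, (vbasis V)`_j);
  rewrite !mem_nth ?size_tuple.
Qed.

Lemma lie_brvP U V W :
  reflect (forall x y, x \in U -> y \in V -> [< x, y >] \in W)
          (lie_brv U V <= W)%VS.
Proof.
apply: (iffP idP) => [sUVW x y Ux Vy|sUVW].
  by rewrite (subvP sUVW) ?memv_lie_br.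
apply/span_subvP=> _ /allpairsP[[x y] /= [Ux Vy ->]].
by apply: sUVW; apply: vbasis_mem.
Qed.

Definition lie_derived : {vspace L} := lie_brv fullv fullv.

Fixpoint lie_lcs (i : nat) : {vspace L} :=
  if i is i'.+1 then lie_brv (lie_lcs i') fullv else fullv.

Definition lie_nilpotent : Prop := exists c, lie_lcs c = 0%VS.

End LowerCentral.

Arguments lie_derived {F} L.
Arguments lie_nilpotent {F} L.

(******************************************************************************)
(* The Heisenberg algebra H(1): row vectors (a, b, c) stand for ax + by + cz. *)
(******************************************************************************)

Section Heisenberg.
Variable F : fieldType.

Definition heisenberg : Type := 'rV[F]_3.

HB.instance Definition _ := Vector.copy heisenberg 'rV[F]_3.

Definition heis_x : heisenberg := delta_mx 0 (inord 0).
Definition heis_y : heisenberg := delta_mx 0 (inord 1).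
Definition heis_z : heisenberg := delta_mx 0 (inord 2).

Let crd (u : heisenberg) (i : nat) : F := (u : 'rV[F]_3) 0 (inord i).

Definition heis_br (u v : heisenberg) : heisenberg :=
  (crd u 0 * crd v 1 - crd u 1 * crd v 0) *: heis_z.

Let crdD u v i : crd (u + v) i = crd u i + crd v i.
Proof. exact: mxE. Qed.
Let crdZ a u i : crd (a *: u) i = a * crd u i.
Proof. exact: mxE. Qed.
Let crd_br u v i : (i < 2)%N -> crd (heis_br u v) i = 0.
Proof.
move=> i2; rewrite crdZ /crd mxE eqxx /= -val_eqE /= !inordK ?(ltn_trans i2) //.
by rewrite (ltn_eqF i2) mulr0.
Qed.

Let heis_brDl u v w : heis_br (u + v) w = heis_br u w + heis_br v w.
Proof. by rewrite /heis_br !crdD -scalerDl !mulrDl opprD addrACA. Qed.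
Let heis_brDr u v w : heis_br u (v + w) = heis_br u v + heis_br u w.
Proof. by rewrite /heis_br !crdD -scalerDl !mulrDr opprD addrACA. Qed.
Let heis_brZl a u v : heis_br (a *: u) v = a *: heis_br u v.
Proof. by rewrite /heis_br !crdZ scalerA mulrBr !mulrA. Qed.
Let heis_brZr a u v : heis_br u (a *: v) = a *: heis_br u v.
Proof. by rewrite /heis_br !crdZ scalerA mulrBr !(mulrCA _ a). Qed.
Let heis_brxx u : heis_br u u = 0.
Proof. by rewrite /heis_br mulrC subrr scale0r. Qed.
Let heis_br_br u v w : heis_br u (heis_br v w) = 0.
Proof. by rewrite {1}/heis_br !crd_br // !mulr0 subrr scale0r. Qed.
Let heis_jacobi u v w :
  heis_br u (heis_br v w) + heis_br v (heis_br w u) + heis_br w (heis_br u v)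
  = 0.
Proof. by rewrite !heis_br_br !addr0. Qed.

HB.instance Definition _ := Lmodule_isLie.Build F heisenberg
  heis_brDl heis_brDr heis_brZl heis_brZr heis_brxx heis_jacobi.

Lemma heis_brxy : [< heis_x, heis_y >] = heis_z.
Proof.
rewrite /lie_br /= /heis_br /crd !mxE !eqxx -!val_eqE /= !inordK //=.
by rewrite mulr1 mulr0 subr0 scale1r.
Qed.

Lemma heis_brxz : [< heis_x, heis_z >] = 0.
Proof. by rewrite -heis_brxy; apply: heis_br_br. Qed.

Lemma heis_bryz : [< heis_y, heis_z >] = 0.
Proof. by rewrite -heis_brxy; apply: heis_br_br. Qed.

End Heisenberg.

(******************************************************************************)
(* The Lie algebra presented by generators X and relations R: Lie expressions *)
(* in X modulo the least congruence containing R and the Lie algebra laws.    *)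
(******************************************************************************)

Inductive lie_term (F : fieldType) (X : Type) : Type :=
| LGen of X
| LZero
| LOpp of lie_term F X
| LAdd of lie_term F X & lie_term F X
| LScale of F & lie_term F X
| LBr of lie_term F X & lie_term F X.

Arguments LGen F {X}.
Arguments LZero {F X}.

HB.instance Definition _ (F : fieldType) (X : Type) :=
  gen_eqMixin (lie_term F X).
HB.instance Definition _ (F : fieldType) (X : Type) :=
  gen_choiceMixin (lie_term F X).

Section Presentation.
Variables (F : fieldType) (X : Type).
Variable R : lie_term F X -> lie_term F X -> Prop.

Inductive lie_cong : lie_term F X -> lie_term F X -> Prop :=
| lc_rel s t : R s t -> lie_cong s t
| lc_refl s : lie_cong s s
| lc_sym s t : lie_cong s t -> lie_cong t s
| lc_trans s t u : lie_cong s t -> lie_cong t u -> lie_cong s u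
| lc_opp s s' : lie_cong s s' -> lie_cong (LOpp s) (LOpp s')
| lc_add s s' t t' :
    lie_cong s s' -> lie_cong t t' -> lie_cong (LAdd s t) (LAdd s' t')
| lc_scale a s s' : lie_cong s s' -> lie_cong (LScale a s) (LScale a s')
| lc_br s s' t t' :
    lie_cong s s' -> lie_cong t t' -> lie_cong (LBr s t) (LBr s' t')
| lc_addA s t u : lie_cong (LAdd s (LAdd t u)) (LAdd (LAdd s t) u)
| lc_addC s t : lie_cong (LAdd s t) (LAdd t s)
| lc_add0 s : lie_cong (LAdd LZero s) s
| lc_addN s : lie_cong (LAdd (LOpp s) s) LZero
| lc_scaleA a b s : lie_cong (LScale a (LScale b s)) (LScale (a * b) s)
| lc_scale1 s : lie_cong (LScale 1 s) s
| lc_scaleDr a s t :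
    lie_cong (LScale a (LAdd s t)) (LAdd (LScale a s) (LScale a t))
| lc_scaleDl a b s :
    lie_cong (LScale (a + b) s) (LAdd (LScale a s) (LScale b s))
| lc_brDl s t u : lie_cong (LBr (LAdd s t) u) (LAdd (LBr s u) (LBr t u))
| lc_brDr s t u : lie_cong (LBr s (LAdd t u)) (LAdd (LBr s t) (LBr s u))
| lc_brZl a s t : lie_cong (LBr (LScale a s) t) (LScale a (LBr s t))
| lc_brZr a s t : lie_cong (LBr s (LScale a t)) (LScale a (LBr s t))
| lc_brxx s : lie_cong (LBr s s) LZero
| lc_jacobi s t u :
    lie_cong (LAdd (LAdd (LBr s (LBr t u)) (LBr t (LBr u s))) (LBr u (LBr s t)))
             LZero.

Definition lie_congb (s t : lie_term F X) : bool := `[< lie_cong s t >].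

Lemma lie_congb_refl : reflexive lie_congb.
Proof. by move=> s; apply/asboolP; apply: lc_refl. Qed.

Lemma lie_congb_sym : symmetric lie_congb.
Proof. by move=> s t; apply/asboolP/asboolP; apply: lc_sym. Qed.

Lemma lie_congb_trans : transitive lie_congb.
Proof.
by move=> t s u /asboolP st /asboolP tu; apply/asboolP; apply: lc_trans st tu.
Qed.

Canonical lie_cong_equiv :=
  EquivRel lie_congb lie_congb_refl lie_congb_sym lie_congb_trans.

Definition lie_pres : Type := {eq_quot lie_congb}.

HB.instance Definition _ := Choice.on lie_pres.
HB.instance Definition _ := Quotient.on lie_pres.

Definition lpi (t : lie_term F X) : lie_pres := \pi_lie_pres t.

Lemma lpiP s t : lpi s = lpi t <-> lie_cong s t.
Proof.
split=> [/(@eqmodP _ lie_cong_equiv)/asboolP //|st].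
by apply/(@eqmodP _ lie_cong_equiv)/asboolP.
Qed.

Lemma lpi_repr (u : lie_pres) : lpi (repr u) = u.
Proof. exact: reprK. Qed.

Lemma repr_lpi t : lie_cong (repr (lpi t)) t.
Proof. by apply/lpiP; rewrite lpi_repr. Qed.

Lemma lie_presW (P : lie_pres -> Prop) : (forall t, P (lpi t)) -> forall u, P u.
Proof. by move=> Ppi u; rewrite -(lpi_repr u). Qed.

Definition lpres_opp (u : lie_pres) := lpi (LOpp (repr u)).
Definition lpres_add (u v : lie_pres) := lpi (LAdd (repr u) (repr v)).
Definition lpres_scale a (u : lie_pres) := lpi (LScale a (repr u)).
Definition lpres_br (u v : lie_pres) := lpi (LBr (repr u) (repr v)).

Let lpi_oppE t : lpres_opp (lpi t) = lpi (LOpp t).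
Proof. by apply/lpiP/lc_opp/repr_lpi. Qed.
Let lpi_addE s t : lpres_add (lpi s) (lpi t) = lpi (LAdd s t).
Proof. by apply/lpiP/lc_add; apply: repr_lpi. Qed.
Let lpi_scaleE a t : lpres_scale a (lpi t) = lpi (LScale a t).
Proof. by apply/lpiP/lc_scale/repr_lpi. Qed.
Let lpi_brE s t : lpres_br (lpi s) (lpi t) = lpi (LBr s t).
Proof. by apply/lpiP/lc_br; apply: repr_lpi. Qed.

Let lpiE := (lpi_oppE, lpi_addE, lpi_scaleE, lpi_brE).

Let lpres_addA : associative lpres_add.
Proof.
by elim/lie_presW=> s; elim/lie_presW=> t; elim/lie_presW=> u; rewrite !lpiE;
  apply/lpiP/lc_addA.
Qed.
Let lpres_addC : commutative lpres_add.
Proof.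
by elim/lie_presW=> s; elim/lie_presW=> t; rewrite !lpiE; apply/lpiP/lc_addC.
Qed.
Let lpres_add0 : left_id (lpi LZero) lpres_add.
Proof. by elim/lie_presW=> s; rewrite !lpiE; apply/lpiP/lc_add0. Qed.
Let lpres_addN : left_inverse (lpi LZero) lpres_opp lpres_add.
Proof. by elim/lie_presW=> s; rewrite !lpiE; apply/lpiP/lc_addN. Qed.

HB.instance Definition _ := GRing.isZmodule.Build lie_pres
  lpres_addA lpres_addC lpres_add0 lpres_addN.

Let lpres_scaleA a b v :
  lpres_scale a (lpres_scale b v) = lpres_scale (a * b) v.
Proof. by elim/lie_presW: v => s; rewrite !lpiE; apply/lpiP/lc_scaleA. Qed.
Let lpres_scale1 : left_id 1 lpres_scale.
Proof. by elim/lie_presW=> s; rewrite !lpiE; apply/lpiP/lc_scale1. Qed.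
Let lpres_scaleDr : right_distributive lpres_scale +%R.
Proof.
move=> a; elim/lie_presW=> s; elim/lie_presW=> t.
by rewrite /GRing.add /= !lpiE; apply/lpiP/lc_scaleDr.
Qed.
Let lpres_scaleDl v : {morph lpres_scale^~ v : a b / a + b}.
Proof.
by elim/lie_presW: v => s a b; rewrite [RHS]/GRing.add /= !lpiE;
  apply/lpiP/lc_scaleDl.
Qed.

HB.instance Definition _ := GRing.Zmodule_isLmodule.Build F lie_pres
  lpres_scaleA lpres_scale1 lpres_scaleDr lpres_scaleDl.

Let lpres_brDl u v w : lpres_br (u + v) w = lpres_br u w + lpres_br v w.
Proof.
elim/lie_presW: u => r; elim/lie_presW: v => s; elim/lie_presW: w => t.
by rewrite /GRing.add /= !lpiE; apply/lpiP/lc_brDl.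
Qed.
Let lpres_brDr u v w : lpres_br u (v + w) = lpres_br u v + lpres_br u w.
Proof.
elim/lie_presW: u => r; elim/lie_presW: v => s; elim/lie_presW: w => t.
by rewrite /GRing.add /= !lpiE; apply/lpiP/lc_brDr.
Qed.
Let lpres_brZl a u v : lpres_br (a *: u) v = a *: lpres_br u v.
Proof.
elim/lie_presW: u => r; elim/lie_presW: v => s.
by rewrite /GRing.scale /= !lpiE; apply/lpiP/lc_brZl.
Qed.
Let lpres_brZr a u v : lpres_br u (a *: v) = a *: lpres_br u v.
Proof.
elim/lie_presW: u => r; elim/lie_presW: v => s.
by rewrite /GRing.scale /= !lpiE; apply/lpiP/lc_brZr.
Qed.
Let lpres_brxx u : lpres_br u u = 0.
Proof.
by elim/lie_presW: u => r; rewrite /GRing.zero /= !lpiE; apply/lpiP/lc_brxx.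
Qed.
Let lpres_jacobi u v w :
  lpres_br u (lpres_br v w) + lpres_br v (lpres_br w u)
    + lpres_br w (lpres_br u v) = 0.
Proof.
elim/lie_presW: u => r; elim/lie_presW: v => s; elim/lie_presW: w => t.
by rewrite /GRing.zero /GRing.add /= !lpiE; apply/lpiP/lc_jacobi.
Qed.

HB.instance Definition _ := Lmodule_isLie.Build F lie_pres
  lpres_brDl lpres_brDr lpres_brZl lpres_brZr lpres_brxx lpres_jacobi.

Lemma lpi0 : lpi LZero = 0. Proof. by []. Qed.
Lemma lpiN t : lpi (LOpp t) = - lpi t.
Proof. by rewrite -lpi_oppE. Qed.
Lemma lpiD s t : lpi (LAdd s t) = lpi s + lpi t.
Proof. by rewrite -lpi_addE. Qed.
Lemma lpiZ a t : lpi (LScale a t) = a *: lpi t.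
Proof. by rewrite -lpi_scaleE. Qed.
Lemma lpi_br s t : lpi (LBr s t) = [< lpi s, lpi t >].
Proof. by rewrite -lpi_brE. Qed.

Definition lgen (x : X) : lie_pres := lpi (LGen F x).

Lemma lie_pres_ind (P : lie_pres -> Prop) :
    (forall x, P (lgen x)) -> P 0 -> (forall u, P u -> P (- u)) ->
    (forall u v, P u -> P v -> P (u + v)) ->
    (forall a u, P u -> P (a *: u)) ->
    (forall u v, P u -> P v -> P [< u, v >]) ->
  forall u, P u.
Proof.
move=> Pg P0 PN PD PZ Pb; elim/lie_presW.
elim=> [x||t Pt|s Ps t Pt|a t Pt|s Ps t Pt]; rewrite ?lpiN ?lpiD ?lpiZ ?lpi_br //.
- exact: Pg.
- exact: PN.
- exact: PD.
- exact: PZ.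
- exact: Pb.
Qed.

Fixpoint lie_eval (M : lieAlgType F) (g : X -> M) (t : lie_term F X) : M :=
  match t with
  | LGen x => g x
  | LZero => 0
  | LOpp s => - lie_eval g s
  | LAdd s s' => lie_eval g s + lie_eval g s'
  | LScale a s => a *: lie_eval g s
  | LBr s s' => [< lie_eval g s, lie_eval g s' >]
  end.

Definition lie_lift (M : lieAlgType F) (g : X -> M) (u : lie_pres) : M :=
  lie_eval g (repr u).

Section Lift.
Variables (M : lieAlgType F) (g : X -> M).
Hypothesis gR : forall s t, R s t -> lie_eval g s = lie_eval g t.

Lemma lie_eval_cong s t : lie_cong s t -> lie_eval g s = lie_eval g t.
Proof.
elim=> //=.
- by move=> ? ? ? _ -> _ ->.
- by move=> ? ? _ ->.
- by move=> ? ? ? ? _ -> _ ->.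
- by move=> ? ? ? _ ->.
- by move=> ? ? ? ? _ -> _ ->.
- by move=> *; rewrite addrA.
- by move=> *; rewrite addrC.
- by move=> *; rewrite add0r.
- by move=> *; rewrite addNr.
- by move=> *; rewrite scalerA.
- by move=> *; rewrite scale1r.
- by move=> *; rewrite scalerDr.
- by move=> *; rewrite scalerDl.
- by move=> *; rewrite lie_brDl.
- by move=> *; rewrite lie_brDr.
- by move=> *; rewrite lie_brZl.
- by move=> *; rewrite lie_brZr.
- by move=> *; rewrite lie_brxx.
- by move=> *; rewrite lie_jacobi.
Qed.

Lemma lie_liftE t : lie_lift g (lpi t) = lie_eval g t.
Proof. exact/lie_eval_cong/repr_lpi. Qed.

Lemma lie_lift_gen x : lie_lift g (lgen x) = g x.
Proof. exact: lie_liftE. Qed.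

Lemma lie_lift_hom : lie_hom (lie_lift g).
Proof.
split=> [a|]; elim/lie_presW=> s; elim/lie_presW=> t.
  by rewrite -lpiZ -lpiD !lie_liftE.
by rewrite -lpi_br !lie_liftE.
Qed.

End Lift.

Fixpoint lie_deval (d : X -> lie_pres) (t : lie_term F X) : lie_pres :=
  match t with
  | LGen x => d x
  | LZero => 0
  | LOpp s => - lie_deval d s
  | LAdd s s' => lie_deval d s + lie_deval d s'
  | LScale a s => a *: lie_deval d s
  | LBr s s' => [< lie_deval d s, lpi s' >] + [< lpi s, lie_deval d s' >]
  end.

(* The derivation of [lie_pres] with prescribed values on the generators.     *)
Definition lie_dlift (d : X -> lie_pres) (u : lie_pres) : lie_pres :=
  lie_deval d (repr u).

Section Derivation.
Variable d : X -> lie_pres.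
Hypothesis dR : forall s t, R s t -> lie_deval d s = lie_deval d t.

Let pR s t : lie_cong s t -> lpi s = lpi t. Proof. by move/lpiP. Qed.

Lemma lie_deval_cong s t : lie_cong s t -> lie_deval d s = lie_deval d t.
Proof.
elim=> //=.
- by move=> ? ? ? _ -> _ ->.
- by move=> ? ? _ ->.
- by move=> ? ? ? ? _ -> _ ->.
- by move=> ? ? ? _ ->.
- by move=> ? ? ? ? /pR -> -> /pR -> ->.
- by move=> *; rewrite scalerDl.
- by move=> *; rewrite lpiD !lie_brDl addrACA.
- by move=> *; rewrite lpiD !lie_brDr addrACA.
- by move=> *; rewrite lpiZ !lie_brZl scalerDr.
- by move=> *; rewrite lpiZ !lie_brZr scalerDr.
- by move=> *; rewrite addrC lie_brC addNr.
move=> {}s {}t u; rewrite !lpi_br !lie_brDr.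
set x := lie_deval d s; set y := lie_deval d t; set z := lie_deval d u.
have Jx := lie_jacobi x (lpi t) (lpi u).
have Jy := lie_jacobi (lpi s) y (lpi u).
have Jz := lie_jacobi (lpi s) (lpi t) z.
rewrite [LHS](AC ((1*2)*(1*2)*(1*2)) ((1*6*8)*(2*4*9)*(3*5*7))%AC) /=.
by rewrite Jx Jy Jz !addr0.
Qed.

Lemma lie_dliftE t : lie_dlift d (lpi t) = lie_deval d t.
Proof. exact/lie_deval_cong/repr_lpi. Qed.

Lemma lie_dlift_gen x : lie_dlift d (lgen x) = d x.
Proof. exact: lie_dliftE. Qed.

Lemma lie_dlift_linear : linear (lie_dlift d).
Proof.
move=> a; elim/lie_presW=> s; elim/lie_presW=> t.
by rewrite -lpiZ -lpiD !lie_dliftE.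
Qed.

Lemma lie_dlift_br u v :
  lie_dlift d [< u, v >] = [< lie_dlift d u, v >] + [< u, lie_dlift d v >].
Proof.
by elim/lie_presW: u => s; elim/lie_presW: v => t; rewrite -lpi_br !lie_dliftE.
Qed.

End Derivation.

End Presentation.

Record lie_action (F : fieldType) (L K : lieAlgType F) := LieAction {
  lact :> L -> K -> K;
  lactDl : forall l l' k, lact (l + l') k = lact l k + lact l' k;
  lactDr : forall l k k', lact l (k + k') = lact l k + lact l k';
  lactZl : forall a l k, lact (a *: l) k = a *: lact l k;
  lactZr : forall a l k, lact l (a *: k) = a *: lact l k;
  lact_brl : forall l l' k,
    lact [< l, l' >] k = lact l (lact l' k) - lact l' (lact l k);
  lact_brr : forall l k k',
    lact l [< k, k' >] = [< lact l k, k' >] + [< k, lact l k' >]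
}.

Definition lie_compatible (F : fieldType) (L K : lieAlgType F)
    (f : lie_action L K) (g : lie_action K L) : Prop :=
  (forall l l' k, g (f l k) l' = [< l', g k l >]) /\
  (forall l k k', f (g k l) k' = [< k', f l k >]).

Inductive tensor_rel (F : fieldType) (L K : lieAlgType F)
    (f : lie_action L K) (g : lie_action K L) :
    lie_term F (L * K) -> lie_term F (L * K) -> Prop :=
| tr_scalel c l k :
    tensor_rel f g (LScale c (LGen F (l, k))) (LGen F (c *: l, k))
| tr_scaler c l k :
    tensor_rel f g (LScale c (LGen F (l, k))) (LGen F (l, c *: k))
| tr_addl l l' k :
    tensor_rel f g (LGen F (l + l', k)) (LAdd (LGen F (l, k)) (LGen F (l', k)))
| tr_addr l k k' :
    tensor_rel f g (LGen F (l, k + k')) (LAdd (LGen F (l, k)) (LGen F (l, k')))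
| tr_brl l l' k :
    tensor_rel f g (LGen F ([< l, l' >], k))
      (LAdd (LGen F (l, f l' k)) (LOpp (LGen F (l', f l k))))
| tr_brr l k k' :
    tensor_rel f g (LGen F (l, [< k, k' >]))
      (LAdd (LGen F (g k' l, k)) (LOpp (LGen F (g k l, k'))))
| tr_br l k l' k' :
    tensor_rel f g (LBr (LGen F (l, k)) (LGen F (l', k')))
      (LOpp (LGen F (g k l, f l' k'))).

Definition lie_tensor (F : fieldType) (L K : lieAlgType F)
    (f : lie_action L K) (g : lie_action K L) (_ : lie_compatible f g) :
    lieAlgType F :=
  lie_pres (tensor_rel f g).

Section Tensor.
Variables (F : fieldType) (L K : lieAlgType F).
Variables (f : lie_action L K) (g : lie_action K L) (fg : lie_compatible f g).

Definition tens (l : L) (k : K) : lie_tensor fg :=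
  lgen (tensor_rel f g) (l, k).

Let rel s t : tensor_rel f g s t ->
  lpi (tensor_rel f g) s = lpi (tensor_rel f g) t.
Proof. by move=> st; apply/lpiP/lc_rel. Qed.

Lemma tensZl c l k : tens (c *: l) k = c *: tens l k.
Proof. by rewrite /tens /lgen -lpiZ (rel (tr_scalel f g c l k)). Qed.
Lemma tensZr c l k : tens l (c *: k) = c *: tens l k.
Proof. by rewrite /tens /lgen -lpiZ (rel (tr_scaler f g c l k)). Qed.
Lemma tensDl l l' k : tens (l + l') k = tens l k + tens l' k.
Proof. by rewrite /tens /lgen (rel (tr_addl f g l l' k)) lpiD. Qed.
Lemma tensDr l k k' : tens l (k + k') = tens l k + tens l k'.
Proof. by rewrite /tens /lgen (rel (tr_addr f g l k k')) lpiD. Qed.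
Lemma tens_brl l l' k :
  tens [< l, l' >] k = tens l (f l' k) - tens l' (f l k).
Proof. by rewrite /tens /lgen (rel (tr_brl f g l l' k)) lpiD lpiN. Qed.
Lemma tens_brr l k k' :
  tens l [< k, k' >] = tens (g k' l) k - tens (g k l) k'.
Proof. by rewrite /tens /lgen (rel (tr_brr f g l k k')) lpiD lpiN. Qed.
Lemma tens_br l k l' k' :
  [< tens l k, tens l' k' >] = - tens (g k l) (f l' k').
Proof. by rewrite /tens /lgen -lpi_br (rel (tr_br f g l k l' k')) lpiN. Qed.

Lemma tensNl l k : tens (- l) k = - tens l k.
Proof. by rewrite -scaleN1r tensZl scaleN1r. Qed.
Lemma tensNr l k : tens l (- k) = - tens l k.
Proof. by rewrite -scaleN1r tensZr scaleN1r. Qed.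

End Tensor.

Section TensorSquare.
Variables (F : fieldType) (L : lieAlgType F).

Definition lie_ad : lie_action L L :=
  @LieAction F L L (@lie_br F L) (@lie_brDl F L) (@lie_brDr F L)
    (@lie_brZl F L) (@lie_brZr F L) (@lie_br_brl F L) (@lie_br_deriv F L).

Lemma lie_ad_compatible : lie_compatible lie_ad lie_ad.
Proof.
by split=> l l' k /=; rewrite lie_brC; congr [< _, _ >] || rewrite -lie_brNr -lie_brC.
Qed.

Definition tensor_square : lieAlgType F := lie_tensor lie_ad_compatible.

Definition tens2 (a b : L) : tensor_square := tens lie_ad_compatible a b.

Lemma tens2_ind (P : tensor_square -> Prop) :
    (forall a b, P (tens2 a b)) -> P 0 -> (forall u, P u -> P (- u)) ->
    (forall u v, P u -> P v -> P (u + v)) ->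
    (forall c u, P u -> P (c *: u)) ->
    (forall u v, P u -> P v -> P [< u, v >]) ->
  forall u, P u.
Proof. by move=> Pg; apply: lie_pres_ind => -[a b]; apply: Pg. Qed.

Definition lie_lambda : tensor_square -> L :=
  lie_lift (R := tensor_rel lie_ad lie_ad) (fun ab => [< ab.1, ab.2 >]).

Let lambda_rel s t : tensor_rel lie_ad lie_ad s t ->
  lie_eval (fun ab => [< ab.1, ab.2 >]) s
    = lie_eval (fun ab : L * L => [< ab.1, ab.2 >]) t.
Proof.
case=> [c l k|c l k|l l' k|l k k'|l l' k|l k k'|l k l' k'] /=.
- by rewrite lie_brZl.
- by rewrite lie_brZr.
- by rewrite lie_brDl.
- by rewrite lie_brDr.
- exact: lie_br_brl.
- rewrite lie_br_deriv addrC (lie_brC [< k', l >] k) -lie_brNr -(lie_brC l k').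
  by rewrite -lie_brNl -(lie_brC l k).
- by rewrite -lie_brNl -lie_brC.
Qed.

Lemma lie_lambda_tens a b : lie_lambda (tens2 a b) = [< a, b >].
Proof. exact: (lie_lift_gen lambda_rel). Qed.

Lemma lie_lambda_hom : lie_hom lie_lambda.
Proof. exact: (lie_lift_hom lambda_rel). Qed.

Let lambdaB u v : lie_lambda [< u, v >] = [< lie_lambda u, lie_lambda v >].
Proof. exact: lie_lambda_hom.2. Qed.
Let lambdaP c u v : lie_lambda (c *: u + v) = c *: lie_lambda u + lie_lambda v.
Proof. exact: lie_lambda_hom.1. Qed.
Let lambda0 : lie_lambda 0 = 0.
Proof. by have := lambdaP (-1) 0 0; rewrite scaler0 addr0 scaleN1r addNr. Qed.
Let lambdaD u v : lie_lambda (u + v) = lie_lambda u + lie_lambda v.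
Proof. by have := lambdaP 1 u v; rewrite !scale1r. Qed.
Let lambdaZ c u : lie_lambda (c *: u) = c *: lie_lambda u.
Proof. by have := lambdaP c u 0; rewrite lambda0 !addr0. Qed.
Let lambdaN u : lie_lambda (- u) = - lie_lambda u.
Proof. by rewrite -scaleN1r lambdaZ scaleN1r. Qed.

Definition tact (x : L) : tensor_square -> tensor_square :=
  lie_dlift (R := tensor_rel lie_ad lie_ad)
    (fun ab => tens2 [< x, ab.1 >] ab.2 + tens2 ab.1 [< x, ab.2 >]).

Let t2Dl a b c : tens2 (a + b) c = tens2 a c + tens2 b c.
Proof. exact: tensDl. Qed.
Let t2Dr a b c : tens2 a (b + c) = tens2 a b + tens2 a c.
Proof. exact: tensDr. Qed.
Let t2Zl k a b : tens2 (k *: a) b = k *: tens2 a b.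
Proof. exact: tensZl. Qed.
Let t2Zr k a b : tens2 a (k *: b) = k *: tens2 a b.
Proof. exact: tensZr. Qed.
Let t2Nl a b : tens2 (- a) b = - tens2 a b.
Proof. exact: tensNl. Qed.
Let t2Nr a b : tens2 a (- b) = - tens2 a b.
Proof. exact: tensNr. Qed.
Let t2_brl a b c :
  tens2 [< a, b >] c = tens2 a [< b, c >] - tens2 b [< a, c >].
Proof. exact: tens_brl. Qed.
Let t2_brr a b c :
  tens2 a [< b, c >] = tens2 [< c, a >] b - tens2 [< b, a >] c.
Proof. exact: tens_brr. Qed.
Let t2_br a b c d :
  [< tens2 a b, tens2 c d >] = - tens2 [< b, a >] [< c, d >].
Proof. exact: tens_br. Qed.

Let tact_rel x s t : tensor_rel lie_ad lie_ad s t ->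
  lie_deval (fun ab => tens2 [< x, ab.1 >] ab.2 + tens2 ab.1 [< x, ab.2 >]) s
    = lie_deval (R := tensor_rel lie_ad lie_ad)
        (fun ab => tens2 [< x, ab.1 >] ab.2 + tens2 ab.1 [< x, ab.2 >]) t.
Proof.
case=> [c l k|c l k|l l' k|l k k'|l l' k|l k k'|l k l' k'] /=.
- by rewrite lie_brZr !t2Zl scalerDr.
- by rewrite lie_brZr !t2Zr scalerDr.
- by rewrite lie_brDr !t2Dl addrACA.
- by rewrite lie_brDr !t2Dr addrACA.
- rewrite (lie_br_deriv x l l') t2Dl !(t2_brl _ _ k) (t2_brl l l' [< x, k >]).
  rewrite (lie_br_deriv x l' k) (lie_br_deriv x l k) !t2Dr !opprD.
  by rewrite [LHS](AC (2*2*2) ((1*(3*5))*(4*(2*6)))%AC).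
- rewrite (lie_br_deriv x k k') t2Dr.
  rewrite !(t2_brr _ k k', t2_brr _ [< x, k >] k', t2_brr _ k [< x, k' >]).
  rewrite (lie_br_deriv x k' l) (lie_br_deriv x k l) !t2Dl !opprD.
  by rewrite [LHS](AC (2*(2*2)) (((5*1)*3)*((4*2)*6))%AC).
- rewrite -/(lgen _ (l, k)) -/(lgen _ (l', k')).
  rewrite -/(tens2 l k) -/(tens2 l' k') lie_brDl lie_brDr !t2_br -!opprD.
  rewrite (lie_br_deriv x k l) (lie_br_deriv x l' k') t2Dl t2Dr.
  by rewrite [in LHS](addrC (tens2 [< k, [< x, l >] >] _)).
Qed.

Let tact_gen x a b : tact x (tens2 a b) = tens2 [< x, a >] b + tens2 a [< x, b >].
Proof. exact: (lie_dlift_gen (tact_rel x)). Qed.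
Let tactP x : linear (tact x).
Proof. exact: (lie_dlift_linear (tact_rel x)). Qed.
Let tact_brr x u v : tact x [< u, v >] = [< tact x u, v >] + [< u, tact x v >].
Proof. exact: (lie_dlift_br (tact_rel x)). Qed.
Let tact0 x : tact x 0 = 0.
Proof. by have := tactP x (-1) 0 0; rewrite scaler0 addr0 scaleN1r addNr. Qed.
Let tactDr x u v : tact x (u + v) = tact x u + tact x v.
Proof. by have := tactP x 1 u v; rewrite !scale1r. Qed.
Let tactZr c x u : tact x (c *: u) = c *: tact x u.
Proof. by have := tactP x c u 0; rewrite tact0 !addr0. Qed.
Let tactNr x u : tact x (- u) = - tact x u.
Proof. by rewrite -scaleN1r tactZr scaleN1r. Qed.

Let tactDl x y u : tact (x + y) u = tact x u + tact y u.
Proof.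
elim/tens2_ind: u => [a b||u IH|u v IHu IHv|c u IH|u v IHu IHv].
- by rewrite !tact_gen !lie_brDl t2Dl t2Dr addrACA.
- by rewrite !tact0 addr0.
- by rewrite !tactNr IH opprD.
- by rewrite !tactDr IHu IHv addrACA.
- by rewrite !tactZr IH scalerDr.
- by rewrite !tact_brr IHu IHv lie_brDl lie_brDr addrACA.
Qed.

Let tactZl c x u : tact (c *: x) u = c *: tact x u.
Proof.
elim/tens2_ind: u => [a b||u IH|u v IHu IHv|k u IH|u v IHu IHv].
- by rewrite !tact_gen !lie_brZl t2Zl t2Zr scalerDr.
- by rewrite !tact0 scaler0.
- by rewrite !tactNr IH scalerN.
- by rewrite !tactDr IHu IHv scalerDr.
- by rewrite !tactZr IH !scalerA mulrC.
- by rewrite !tact_brr IHu IHv lie_brZl lie_brZr scalerDr.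
Qed.

Let tact_brl x y u :
  tact [< x, y >] u = tact x (tact y u) - tact y (tact x u).
Proof.
elim/tens2_ind: u => [a b||u IH|u v IHu IHv|c u IH|u v IHu IHv].
- rewrite !tact_gen !tactDr !tact_gen !lie_br_brl !(t2Dl, t2Dr, t2Nl, t2Nr).
  rewrite !opprD.
  set p1 := tens2 [< x, [< y, a >] >] b; set p2 := tens2 [< y, [< x, a >] >] b.
  set p3 := tens2 a [< x, [< y, b >] >]; set p4 := tens2 a [< y, [< x, b >] >].
  set q1 := tens2 [< x, a >] [< y, b >]; set q2 := tens2 [< y, a >] [< x, b >].
  rewrite [RHS](AC ((2*2)*(2*2)) (((1*5)*(4*8))*((3*6)*(2*7)))%AC) /=.
  by rewrite !subrr !addr0.
- by rewrite !tact0 subr0.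
- by rewrite !tactNr IH opprD.
- by rewrite !tactDr IHu IHv opprD addrACA.
- by rewrite !tactZr IH scalerBr.
- rewrite !tact_brr !tactDr !tact_brr IHu IHv lie_brDl lie_brDr lie_brNl lie_brNr.
  set p1 := [< tact x (tact y u), v >]; set p2 := [< tact y (tact x u), v >].
  set p3 := [< u, tact x (tact y v) >]; set p4 := [< u, tact y (tact x v) >].
  set q1 := [< tact x u, tact y v >]; set q2 := [< tact y u, tact x v >].
  rewrite !opprD.
  rewrite [RHS](AC ((2*2)*(2*2)) (((1*5)*(4*8))*((3*6)*(2*7)))%AC) /=.
  by rewrite !subrr !addr0.
Qed.

Definition square_lact : lie_action L tensor_square :=
  LieAction tactDl tactDr tactZl tactZr tact_brl tact_brr.

Lemma square_lact_tens x a b :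
  square_lact x (tens2 a b) = tens2 [< x, a >] b + tens2 a [< x, b >].
Proof. exact: tact_gen. Qed.

Let ract (t : tensor_square) (l : L) : L := [< lie_lambda t, l >].

Let ractDl t t' l : ract (t + t') l = ract t l + ract t' l.
Proof. by rewrite /ract lambdaD lie_brDl. Qed.
Let ractDr t l l' : ract t (l + l') = ract t l + ract t l'.
Proof. exact: lie_brDr. Qed.
Let ractZl c t l : ract (c *: t) l = c *: ract t l.
Proof. by rewrite /ract lambdaZ lie_brZl. Qed.
Let ractZr c t l : ract t (c *: l) = c *: ract t l.
Proof. exact: lie_brZr. Qed.
Let ract_brl t t' l : ract [< t, t' >] l = ract t (ract t' l) - ract t' (ract t l).
Proof. by rewrite /ract lambdaB lie_br_brl. Qed.
Let ract_brr t l l' : ract t [< l, l' >] = [< ract t l, l' >] + [< l, ract t l' >].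
Proof. exact: lie_br_deriv. Qed.

Definition square_ract : lie_action tensor_square L :=
  LieAction ractDl ractDr ractZl ractZr ract_brl ract_brr.

Lemma square_ractE t l : square_ract t l = [< lie_lambda t, l >].
Proof. by []. Qed.

Lemma square_lact_lambda s t : square_lact (lie_lambda s) t = [< s, t >].
Proof.
rewrite /=; elim/tens2_ind: s t
  => [a b||s IH|s s' IHs IHs'|c s IH|s s' IHs IHs'] t.
- elim/tens2_ind: t => [c d||t IH|t t' IHt IHt'|k t IH|t t' IHt IHt'].
  + rewrite lie_lambda_tens tact_gen t2_br -t2Nl -lie_brC.
    by rewrite (t2_brl [< a, b >]) subrK.
  + by rewrite tact0 lie_br0r.
  + by rewrite tactNr IH lie_brNr.
  + by rewrite tactDr IHt IHt' lie_brDr.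
  + by rewrite tactZr IH lie_brZr.
  + by rewrite tact_brr IHt IHt' [in RHS]lie_br_deriv.
- by have := tactZl 0 0 t; rewrite !scale0r lambda0 lie_br0l.
- by rewrite lambdaN -scaleN1r tactZl IH scaleN1r lie_brNl.
- by rewrite lambdaD tactDl IHs IHs' lie_brDl.
- by rewrite lambdaZ tactZl IH lie_brZl.
- by rewrite lambdaB tact_brl !IHs !IHs' lie_br_brl.
Qed.

Lemma lie_lambda_lact x t : lie_lambda (square_lact x t) = [< x, lie_lambda t >].
Proof.
rewrite /=; elim/tens2_ind: t => [a b||t IH|t t' IHt IHt'|c t IH|t t' IHt IHt'].
- by rewrite tact_gen lambdaD !lie_lambda_tens -lie_br_deriv.
- by rewrite tact0 lambda0 lie_br0r.
- by rewrite tactNr !lambdaN IH lie_brNr.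
- by rewrite tactDr !lambdaD IHt IHt' lie_brDr.
- by rewrite tactZr !lambdaZ IH lie_brZr.
- by rewrite tact_brr lambdaD !lambdaB IHt IHt' -lie_br_deriv.
Qed.

Lemma square_compatible : lie_compatible square_ract square_lact.
Proof.
split=> [t t' l|t l l'].
  rewrite (lie_brC t') -square_lact_lambda lie_lambda_lact square_ractE.
  by rewrite (lie_brC l) -(scaleN1r [< _, l >]) lactZl scaleN1r opprK.
by rewrite !square_ractE lie_lambda_lact lie_brC (lie_brC l (lie_lambda t))
           lie_brNr opprK.
Qed.

Definition triple_tensor : lieAlgType F := lie_tensor square_compatible.

End TensorSquare.

(* Main.v *)
From HB Require Import structures.
Require Import Defs.
From mathcomp Require Import all_boot all_algebra.
From mathcomp Require Import boolp ring.

(** The upper bound is a count of generators. In a tensor product of L and K the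
    relation l (x) [a, b] = (b l) (x) a - (a l) (x) b, where b l is the action
    of b on l, replaces a bracket in the right factor by an action on the left
    factor. If K acts nilpotently on L the process ends, and L (x) K is spanned
    by the tensors e (x) x with e in a basis of L and x in a basis of a
    complement of the derived subalgebra of K ([tens_spans]). For L nilpotent
    this applies to L (x) L, with n (n - m) generators, and then to (L (x) L)
    (x) L, because L also acts nilpotently on its tensor square
    ([nilpotent_square_lact]); together they give n (n - m)^2 generators.

    Let m = 1. Then the derived subalgebra is a central line spanned by some z =
    [x, y], and x, y, z are independent, so n >= 3. If n > 3, any w independent
    of x, y, z gives a redundant generator: z (x) w is a combination of z (x) x
    and z (x) y. Removing it lowers the bound strictly ([triple_tensor_strict]).
    If n = 3, the basis x, y, z identifies L with H(1) ([heisenberg_isom]).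

    Conversely, for L isomorphic to H(1) the bound is 12, and it is attained
    because the triple tensor product maps linearly onto a space of dimension 12
    ([heisenberg_triple_map]). The tensor square of H(1) is abelian of dimension
    6 and acts trivially on H(1), so that after elimination of z a tensor t (x)
    l is determined by its components along x and y, each of them in a space of
    dimension 6. *)

(** * Spanning families and dimensions of modules *)

Section Spanning.
Local Set Implicit Arguments.
Local Unset Strict Implicit.
Import GRing.Theory.
Local Open Scope ring_scope.
Variable F : fieldType.

Definition lin_closed (V : lmodType F) (P : V -> Prop) : Prop :=
  P 0 /\ forall a u v, P u -> P v -> P (a *: u + v).

Section LinClosed.
Variables (V : lmodType F) (P : V -> Prop).
Hypothesis linP : lin_closed P.

Lemma lin_closedD u v : P u -> P v -> P (u + v).
Proof. by move=> Pu Pv; rewrite -(scale1r u); apply: linP.2. Qed.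

Lemma lin_closedZ a u : P u -> P (a *: u).
Proof.
by move=> Pu; rewrite -(addr0 (a *: u)); apply: linP.2 => //; apply: linP.1.
Qed.

Lemma lin_closedN u : P u -> P (- u).
Proof. by rewrite -scaleN1r; apply: lin_closedZ. Qed.

Lemma lin_closedB u v : P u -> P v -> P (u - v).
Proof. by move=> Pu Pv; apply: lin_closedD => //; apply: lin_closedN. Qed.

Lemma lin_closed_sum (I : Type) (r : seq I) (E : I -> V) :
  (forall i, P (E i)) -> P (\sum_(i <- r) E i).
Proof.
by move=> PE; elim/big_ind: _ => //; [apply: linP.1 | apply: lin_closedD].
Qed.

End LinClosed.

(** Quantifying over the predicates closed under linear combinations, instead
    of asking for coefficients, turns every spanning argument into an
    induction, and applies to modules not yet known to be finite dimensional. *)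
Definition spans (V : lmodType F) (s : seq V) : Prop :=
  forall P : V -> Prop, lin_closed P -> {in s, forall v, P v} -> forall v, P v.

Definition lin_comb (V : lmodType F) k (e : 'I_k -> V) (c : 'rV[F]_k) : V :=
  \sum_i c 0 i *: e i.

Lemma lin_comb_is_linear (V : lmodType F) k (e : 'I_k -> V) :
  linear (lin_comb e).
Proof.
move=> a u v; rewrite /lin_comb scaler_sumr -big_split /=.
by apply: eq_bigr => i _; rewrite !mxE scalerDl scalerA.
Qed.

HB.instance Definition _ (V : lmodType F) k (e : 'I_k -> V) :=
  GRing.isLinear.Build F 'rV[F]_k V *:%R (lin_comb e) (lin_comb_is_linear e).

Lemma lin_comb_delta (V : lmodType F) k (e : 'I_k -> V) i :
  lin_comb e (delta_mx 0 i) = e i.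
Proof.
rewrite /lin_comb (bigD1 i) //= mxE !eqxx scale1r big1 ?addr0 // => j /negPf ji.
by rewrite mxE ji scale0r.
Qed.

(** [V] has no subspace theory, so the kernel of [g] is obtained as a subspace
    of [W] of largest dimension among those that [g] kills: adjoining a
    further element of the kernel would increase the dimension. *)
Lemma max_subkernel (V : lmodType F) (W : vectType F) (g : {linear W -> V}) :
  exists K : {vspace W}, forall w, w \in K <-> g w = 0.
Proof.
pose kerdim d := `[< exists2 K : {vspace W}, \dim K = d &
                      forall w, w \in K -> g w = 0 >].
have ex0 : exists d, kerdim d.
  exists 0%N; apply/asboolP; exists 0%VS; first by rewrite dimv0.
  by move=> w /[!memv0] /eqP ->; rewrite linear0.
have bnd d : kerdim d -> (d <= \dim {:W})%N.
  by move/asboolP=> [K <- _]; apply: dimvS; apply: subvf.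
case: (ex_maxnP ex0 bnd) => d /asboolP[K dimK gK0] maxd.
exists K => w; split=> [|gw0]; first exact: gK0.
have: kerdim (\dim (K + <[w]>)).
  apply/asboolP; exists (K + <[w]>)%VS => // v.
  case/memv_addP=> u Ku [_ /vlineP[a ->] ->].
  by rewrite linearD linearZ_LR gw0 scaler0 addr0; apply: gK0.
move/maxd; rewrite -dimK => leK.
have /eqP -> : (K == K + <[w]>)%VS by rewrite eqEdim addvSl leK.
exact: (subvP (addvSr K <[w]>) _ (memv_line w)).
Qed.

Lemma dim_rV d : dim 'rV[F]_d = d.
Proof. exact: mul1n. Qed.

(** The linear combination map from row vectors onto [V] becomes bijective once
    restricted to a complement of its kernel. *)
Lemma spans_has_dim (V : lmodType F) (s : seq V) :
  spans s -> exists2 d, has_dim V d & (d <= size s)%N.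
Proof.
move=> spans_s.
pose g : {linear 'rV[F]_(size s) -> V} := lin_comb (fun i => s`_i).
have g_surj v : exists c, g c = v.
  apply: (spans_s (fun v => exists c, g c = v)) v => [|v sv].
    split=> [|a _ _ [c <-] [c' <-]]; first by exists 0; rewrite linear0.
    by exists (a *: c + c'); rewrite linearPZ.
  exists (delta_mx 0 (Ordinal (etrans (index_mem v s) sv))).
  by apply: etrans (lin_comb_delta _ _) _; rewrite /= nth_index.
have [K kerK] := max_subkernel g.
pose C := (K^C)%VS.
pose b : {linear 'rV[F]_(\dim C) -> 'rV[F]_(size s)} :=
  lin_comb (fun i => (vbasis C)`_i).
have bC a : b a \in C.
  apply: memv_suml => i _; apply: memvZ; apply: vbasis_mem.
  by rewrite mem_nth ?size_tuple.
have b_inj a : b a = 0 -> a = 0.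
  move=> ba0; apply/rowP=> i; rewrite mxE.
  by have /freeP := basis_free (vbasisP C); apply.
have gb_inj : injective (g \o b).
  move=> a a' /= eq_gb; apply/eqP; rewrite -subr_eq0; apply/eqP/b_inj.
  apply/eqP; rewrite -memv0 -(capv_compl K) memv_cap bC andbT.
  by apply/kerK; rewrite !linearB /= eq_gb subrr.
have gb_surj v : exists a, g (b a) = v.
  have [c <-] := g_surj v; have := memvf c; rewrite -(addv_complf K).
  case/memv_addP=> u Ku [w Cw ->]; exists (\row_i coord (vbasis C) i w).
  rewrite linearD (kerK u).1 // add0r; congr (g _).
  rewrite [RHS](coord_vbasis Cw).
  by apply: eq_bigr => i _; rewrite mxE.
have [r rK] := choice gb_surj.
exists (\dim C); last first.
  by have := dimvS (subvf C); rewrite dimvf dim_rV.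
have r_lin : linear r.
  by move=> a u v; apply: gb_inj; rewrite /= !linearP /= !rK.
constructor; exists r => //; exists (g \o b) => a; first exact: rK.
by apply: gb_inj; rewrite /= rK.
Qed.

Lemma dim_surj (V W : vectType F) (h : V -> W) :
  linear h -> (forall w, exists v, h v = w) -> (dim W <= dim V)%N.
Proof.
move=> h_lin h_surj.
pose hL : {linear V -> W} :=
  HB.pack h (GRing.isLinear.Build _ _ _ *:%R h h_lin).
have img : limg (linfun hL) = fullv.
  apply/vspaceP=> w; rewrite memvf; apply/memv_imgP; have [v <-] := h_surj w.
  by exists v; rewrite ?memvf // lfunE.
have := limg_ker_dim (linfun hL) fullv; rewrite img !dimvf => <-.
exact: leq_addl.
Qed.

(** This is how dimensions are bounded from below: a presented algebra is only
    accessible through the maps that leave it. *)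
Lemma has_dim_surj (V : lmodType F) (W : vectType F) d (h : V -> W) :
  has_dim V d -> linear h -> (forall w, exists v, h v = w) -> (dim W <= d)%N.
Proof.
move=> [[r r_lin [r' rK r'K]]] h_lin h_surj; rewrite -(dim_rV d).
have r'_lin : linear r'.
  by move=> a u v; apply: (can_inj rK); rewrite r_lin !r'K.
apply: (@dim_surj _ _ (h \o r')) => [a u v|w]; first by rewrite /= r'_lin h_lin.
by have [v <-] := h_surj w; exists (r v); rewrite /= rK.
Qed.

Lemma has_dim_inj (V : lmodType F) d d' : has_dim V d -> has_dim V d' -> d = d'.
Proof.
move=> dimd dimd'; apply/anti_leq/andP.
move: dimd dimd' => [[r r_lin [r' rK r'K]]] [[q q_lin [q' qK q'K]]].
split.
  have := @has_dim_surj V 'rV[F]_d d' r; rewrite dim_rV; apply=> //.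
    by constructor; exists q => //; exists q'.
  by move=> w; exists (r' w).
have := @has_dim_surj V 'rV[F]_d' d q; rewrite dim_rV; apply=> //.
  by constructor; exists r => //; exists r'.
by move=> w; exists (q' w).
Qed.

End Spanning.

(** * Tensors with respect to a nilpotent action *)

Section TensorSpanning.
Local Set Implicit Arguments.
Local Unset Strict Implicit.
Import GRing.Theory.
Local Open Scope ring_scope.
Variable F : fieldType.

(** The family spans the quotient of [K] by its derived subalgebra. *)
Definition spans_mod_derived (K : lieAlgType F) (s : seq K) : Prop :=
  forall P : K -> Prop, lin_closed P -> {in s, forall v, P v} ->
    (forall a b, P [< a, b >]) -> forall v, P v.

Section Action.
Variables (L K : lieAlgType F) (g : lie_action K L).

Lemma lact0 k : g k 0 = 0.
Proof. by have := lactZr g 0 k 0; rewrite !scale0r. Qed.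

(** Membership in the [i]-th term of the ascending central series of the action
    of [K] on [L]. *)
Fixpoint killed_in (i : nat) (l : L) : Prop :=
  if i is j.+1 then forall k, killed_in j (g k l) else l = 0.

Definition nilpotent_action : Prop := exists i, forall l, killed_in i l.

Lemma killed_in_lin i : lin_closed (killed_in i).
Proof.
elim: i => [|i [IH0 IHP]]; split=> //=.
- by move=> a _ _ -> ->; rewrite scaler0 addr0.
- by move=> k; rewrite lact0.
- by move=> a u v Ku Kv k; rewrite lactDr lactZr; apply: IHP.
Qed.

End Action.

Section Tensor.
Variables (L K : lieAlgType F) (f : lie_action L K) (g : lie_action K L).
Variable fg : lie_compatible f g.

(** The bracket of two tensors is again, up to sign, a tensor; hence the span of
    the tensors is closed under brackets and is the whole algebra.  Closure of
    that span under brackets is proved one argument at a time, each time by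
    applying the universal property of the span to the other argument. *)
Lemma lie_tensor_lin_ind (P : lie_tensor fg -> Prop) :
  lin_closed P -> (forall l k, P (tens fg l k)) -> forall u, P u.
Proof.
move=> linP Ptens u.
pose S (v : lie_tensor fg) := forall Q : lie_tensor fg -> Prop,
  lin_closed Q -> (forall l k, Q (tens fg l k)) -> Q v.
suff: S u by apply.
elim/(@lie_pres_ind F _ (tensor_rel f g)): u
  => [[l k]||v Sv|v w Sv Sw|a v Sv|v w Sv Sw] Q linQ Qtens.
- exact: Qtens.
- exact: linQ.1.
- by apply: lin_closedN => //; apply: Sv.
- by apply: lin_closedD => //; [apply: Sv | apply: Sw].
- by apply: lin_closedZ => //; apply: Sv.
apply: (Sv (fun v => Q [< v, w >])) => [|l k].
  split=> [|a x y Qx Qy]; first by rewrite lie_br0l; apply: linQ.1.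
  by rewrite lie_brDl lie_brZl; apply: linQ.2.
apply: (Sw (fun w => Q [< tens fg l k, w >])) => [|l' k'].
  split=> [|a x y Qx Qy]; first by rewrite lie_br0r; apply: linQ.1.
  by rewrite lie_brDr lie_brZr; apply: linQ.2.
by rewrite tens_br; apply: lin_closedN.
Qed.

Lemma tens0l k : tens fg 0 k = 0.
Proof. by have := tensZl fg 0 0 k; rewrite !scale0r. Qed.
Lemma tens0r l : tens fg l 0 = 0.
Proof. by have := tensZr fg 0 l 0; rewrite !scale0r. Qed.

Lemma lin_closed_tensl (P : lie_tensor fg -> Prop) k :
  lin_closed P -> lin_closed (fun l => P (tens fg l k)).
Proof.
move=> linP; split=> [|a u v Pu Pv]; first by rewrite tens0l; apply: linP.1.
by rewrite tensDl tensZl; apply: linP.2.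
Qed.

Lemma lin_closed_tensr (P : lie_tensor fg -> Prop) l :
  lin_closed P -> lin_closed (fun k => P (tens fg l k)).
Proof.
move=> linP; split=> [|a u v Pu Pv]; first by rewrite tens0r; apply: linP.1.
by rewrite tensDr tensZr; apply: linP.2.
Qed.

(** The relation for [l] tensored with [[< a, b >]] trades a bracket in the
    right factor for the action of [b] or [a] on [l].  When [K] acts nilpotently
    this can happen only finitely often, so that the right factor matters only
    modulo the derived subalgebra of [K]. *)
Lemma tens_spans (sL : seq L) (sK : seq K) :
    nilpotent_action g -> spans sL -> spans_mod_derived sK ->
  spans [seq tens fg l k | l <- sL, k <- sK].
Proof.
move=> [c gnil] spanL spanK P linP Ps; apply: lie_tensor_lin_ind => // l k.
have Psk : forall k', k' \in sK -> forall l', P (tens fg l' k').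
  move=> k' sk'; apply: spanL => [|l' sl']; first exact: lin_closed_tensl.
  by apply: Ps; apply: allpairs_f.
suff Pkilled i : forall l', killed_in g i l' -> forall k', P (tens fg l' k').
  exact: (Pkilled c).
elim: i => [_ -> k'|i IH l' kill_l']; first by rewrite tens0l; apply: linP.1.
apply: spanK => [|k' sk'|a b]; first exact: lin_closed_tensr.
  exact: Psk.
by rewrite tens_brr; apply: lin_closedB => //; apply: IH; apply: kill_l'.
Qed.

End Tensor.

Lemma nilpotent_ad (L : vectLieAlgType F) :
  lie_nilpotent L -> nilpotent_action (lie_ad L).
Proof.
move=> [c lcs0]; exists c => l.
suff kill i : forall j v, (i + j)%N = c -> v \in lie_lcs L j ->
  killed_in (lie_ad L) i v by apply: (kill c 0%N); rewrite ?addn0 ?memvf.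
elim: i => [|i IH] j v /= ijc vj.
  by apply/eqP; rewrite -memv0 -lcs0 -ijc.
move=> k; apply: (IH j.+1); first by rewrite addnS.
by rewrite lie_brC memvN; apply: memv_lie_br; rewrite ?memvf.
Qed.

(** Leibniz rule: if [p]-fold brackets kill [a] and [q]-fold brackets kill [b],
    then any [p + q] actions on the tensor of [a] and [b] put either at least
    [p] of them on [a] or at least [q] of them on [b]. *)
Lemma nilpotent_square_lact (L : lieAlgType F) :
  nilpotent_action (lie_ad L) -> nilpotent_action (square_lact L).
Proof.
move=> [c adnil]; exists (c + c)%N.
have kill i : forall p q a b, (p + q)%N = i -> killed_in (lie_ad L) p a ->
    killed_in (lie_ad L) q b -> killed_in (square_lact L) i (tens2 a b).
  elim: i => [|i IH] p q a b pqi ka kb.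
    by move: p q pqi ka kb => [|//] [|//] _ /= -> ->; rewrite /tens2 tens0l.
  case: p pqi ka => [|p] pqi ka; first by rewrite ka /tens2 tens0l;
    apply: (killed_in_lin _ _).1.
  case: q pqi kb => [|q] pqi kb; first by rewrite kb /tens2 tens0r;
    apply: (killed_in_lin _ _).1.
  move=> x; rewrite square_lact_tens; apply: lin_closedD.
  - exact: killed_in_lin.
  - by apply: (IH p q.+1) => //; [case: pqi | apply: ka].
  - by apply: (IH p.+1 q) => //; [case: pqi => <-; rewrite addnS | apply: kb].
apply: lie_tensor_lin_ind; first exact: killed_in_lin.
by move=> a b; apply: (kill _ c c).
Qed.

End TensorSpanning.

(** * The upper bound, and its failure to be sharp for n > 3 *)

Section UpperBound.
Local Set Implicit Arguments.
Local Unset Strict Implicit.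
Import GRing.Theory.
Local Open Scope ring_scope.
Variable F : fieldType.

Lemma lin_closed_span (V : vectType F) (P : V -> Prop) (s : seq V) :
  lin_closed P -> {in s, forall v, P v} -> forall v, v \in <<s>>%VS -> P v.
Proof.
move=> linP Ps v /(@coord_span _ _ _ (in_tuple s)) ->.
apply: lin_closed_sum => // i; apply: lin_closedZ => //.
by apply: Ps; rewrite mem_nth.
Qed.

Lemma spans_mod_derivedI (L : vectLieAlgType F) (s : seq L) :
  (lie_derived L + <<s>>)%VS = fullv -> spans_mod_derived s.
Proof.
move=> sumL P linP Ps Pbr v; have := memvf v; rewrite -sumL.
case/memv_addP=> u Lu [w sw ->]; apply: lin_closedD => //.
  apply: (lin_closed_span linP _ Lu) => _ /allpairsP[[a b] [_ _ ->]].
  exact: Pbr.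
exact: (lin_closed_span linP Ps).
Qed.

Lemma triple_tensor_dim (L : lieAlgType F) (T : seq (tensor_square L))
    (s : seq L) :
    nilpotent_action (lie_ad L) -> spans T -> spans_mod_derived s ->
  exists2 d, has_dim (triple_tensor L) d & (d <= size T * size s)%N.
Proof.
move=> adnil spanT spans_s.
rewrite -(size_allpairs (tens (square_compatible L))).
apply: spans_has_dim.
exact: tens_spans (nilpotent_square_lact adnil) spanT spans_s.
Qed.

(** Both tensor products are instances of [tens_spans]: a basis of [L] and a
    basis of a complement of the derived subalgebra give [n * (n - m)]
    generators of the tensor square, and the same complement multiplies their
    number by [n - m] again. *)
Lemma triple_tensor_bound (L : vectLieAlgType F) :
    lie_nilpotent L ->
  let n := \dim (fullv : {vspace L}) in let m := \dim (lie_derived L) in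
  exists2 d, has_dim (triple_tensor L) d & (d <= n * (n - m) ^ 2)%N.
Proof.
move=> /nilpotent_ad adnil n m.
pose e : seq L := vbasis fullv; pose s : seq L := vbasis (lie_derived L)^C.
have span_e : spans e.
  move=> P linP Pe v; apply: (lin_closed_span linP Pe).
  by rewrite (span_basis (vbasisP _)) memvf.
have span_s : spans_mod_derived s.
  by apply: spans_mod_derivedI; rewrite (span_basis (vbasisP _)) addv_complf.
have [d dimd le_d] :=
  triple_tensor_dim adnil
    (tens_spans (fg := lie_ad_compatible L) adnil span_e span_s) span_s.
exists d => //; move: le_d.
by rewrite size_allpairs !size_tuple dimv_compl -mulnA mulnn.
Qed.

Lemma heisenberg_br (M : lieAlgType F) (x y z : M) a b c a' b' c' :
    [< x, y >] = z -> [< x, z >] = 0 -> [< y, z >] = 0 ->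
  [< a *: x + b *: y + c *: z, a' *: x + b' *: y + c' *: z >]
    = (a * b' - b * a') *: z.
Proof.
move=> xy xz yz.
have yx : [< y, x >] = - z by rewrite lie_brC xy.
have zx : [< z, x >] = 0 by rewrite lie_brC xz oppr0.
have zy : [< z, y >] = 0 by rewrite lie_brC yz oppr0.
rewrite !(lie_brDl, lie_brDr, lie_brZl, lie_brZr) !lie_brxx xy xz yz yx zx zy.
rewrite !(scaler0, addr0, add0r) !scalerA scalerN scalerBl.
by rewrite mulrC [b' * a]mulrC mulrC.
Qed.

Definition heis_crd (i : nat) (u : heisenberg F) : F :=
  (u : 'rV[F]_3) 0 (inord i).

Lemma heis_crd_is_linear i a u v :
  heis_crd i (a *: u + v) = a * heis_crd i u + heis_crd i v.
Proof. by rewrite /heis_crd !mxE. Qed.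

Lemma heis_crdE a b c (u := a *: heis_x F + b *: heis_y F + c *: heis_z F) :
  [/\ heis_crd 0 u = a, heis_crd 1 u = b & heis_crd 2 u = c].
Proof.
by split; rewrite /heis_crd !mxE !eqxx -!val_eqE /= !inordK //=;
  rewrite !(mulr0, mulr1, addr0, add0r).
Qed.

Lemma heis_eta (u : heisenberg F) :
  u = heis_crd 0 u *: heis_x F + heis_crd 1 u *: heis_y F
        + heis_crd 2 u *: heis_z F.
Proof.
set v := RHS.
have [v0 v1 v2] := heis_crdE (heis_crd 0 u) (heis_crd 1 u) (heis_crd 2 u).
apply/rowP=> i; rewrite -[i]inord_val.
by case: i => [[|[|[|//]]] ?]; symmetry.
Qed.

Section DerivedLine.
Variables (L : vectLieAlgType F) (x y z : L).
Hypothesis nilL : lie_nilpotent L.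
Hypothesis dimL' : \dim (lie_derived L) = 1%N.
Hypothesis xy_z : [< x, y >] = z.
Hypothesis z_neq0 : z != 0.

Lemma derived_lineE : lie_derived L = <[z]>%VS.
Proof.
apply/esym/eqP; rewrite eqEdim dimL' dim_vline z_neq0 -memvE -xy_z.
by rewrite memv_lie_br ?memvf.
Qed.

Lemma derived_line a b : exists c, [< a, b >] = c *: z.
Proof. by apply/vlineP; rewrite -derived_lineE memv_lie_br ?memvf. Qed.

(** A bracket [[< l, z >] = c *: z] with [c != 0] would make [z] an eigenvector,
    with nonzero eigenvalue, of the nilpotent map given by [l]. *)
Lemma derived_line_central l : [< l, z >] = 0.
Proof.
have [c lz] := derived_line l z; rewrite lz.
have [-> | c_neq0] := eqVneq c 0; first by rewrite scale0r.
have [i kill] := nilpotent_ad nilL; have := kill z.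
elim: i {kill} => [/= ->|i IH kill]; first by rewrite scaler0.
apply: IH; have /= := kill l; rewrite lz => kill'.
by rewrite -[z](scalerK c_neq0); apply: lin_closedZ => //; apply: killed_in_lin.
Qed.

Lemma derived_line_central_l l : [< z, l >] = 0.
Proof. by rewrite lie_brC derived_line_central oppr0. Qed.

Lemma derived_line_free : free [:: y; x; z].
Proof.
rewrite !free_cons nil_free !span_cons span_nil addv0 memv0 z_neq0 !andbT.
apply/andP; split.
  apply/memv_addP=> -[_ /vlineP[a ->] [_ /vlineP[b ->] y_def]].
  case/eqP: z_neq0; rewrite -xy_z y_def lie_brDr !lie_brZr lie_brxx.
  by rewrite derived_line_central !scaler0 addr0.
apply/negP=> /vlineP[a x_def]; case/eqP: z_neq0.
by rewrite -xy_z x_def lie_brZl derived_line_central_l scaler0.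
Qed.

(** As soon as there is a fourth basis vector [w] besides [x], [y] and [z], one
    of the generators of the tensor square is redundant.  Expanding
    [z = [< x, y >]] in the left factor gives [z (x) w] as a combination of
    [x (x) z] and [y (x) z], and expanding it in the right factor turns these
    into [- z (x) x] and [- z (x) y]; so [z (x) w] lies in the span of
    [z (x) x] and [z (x) y], which are generators too. *)
Lemma triple_tensor_strict (n := \dim (fullv : {vspace L})) :
  (3 < n)%N ->
  exists2 d, has_dim (triple_tensor L) d & (d < n * (n - 1) ^ 2)%N.
Proof.
move=> n_gt3; have adnil := nilpotent_ad nilL.
have /subvPn[w _ w_notin] : ~~ (fullv <= <<[:: y; x; z]>>)%VS.
  apply: contraL n_gt3 => /dimvS le_n; rewrite -leqNgt.
  exact: leq_trans le_n (dim_span _).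
have w_free : free [:: w; y; x; z].
  by rewrite free_cons w_notin derived_line_free.
pose s' : seq L := vbasis <<[:: w; y; x; z]>>^C.
pose s := [:: x, y, w & s'].
have size_s : size s = n.-1.
  rewrite /= size_tuple dimv_compl (eqnP w_free) /= -/n.
  by case: (n) n_gt3 => [|[|[|[|k]]]] //= _; rewrite !subSS subn0.
have sum_s : (<[z]> + <<s>>)%VS = fullv.
  have : (<<[:: w; y; x; z]>> + <<s'>> = fullv)%VS.
    by rewrite (span_basis (vbasisP _)) addv_complf.
  rewrite -!span_cat -span_cons => <-; apply: eq_span => v.
  by rewrite !(inE, mem_cat); do 4![case: (v == _)]; rewrite ?orbT.
have span_s : spans_mod_derived s.
  by apply: spans_mod_derivedI; rewrite derived_lineE.
have span_zs : spans (z :: s).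
  move=> P linP Ps v; apply: (lin_closed_span linP Ps).
  by rewrite span_cons sum_s memvf.
have spanT := tens_spans (fg := lie_ad_compatible L) adnil span_zs span_s.
pose T := [:: tens2 z x, tens2 z y & [seq tens2 z v | v <- s'] ++
              [seq tens2 l k | l <- s, k <- s]].
have {}spanT : spans T.
  move=> P linP PT; apply: spanT => // v.
  have Pzx : P (tens2 z x) by apply: PT; rewrite !inE eqxx.
  have Pzy : P (tens2 z y) by apply: PT; rewrite !inE eqxx orbT.
  have [[a yw] [b xw]] := (derived_line y w, derived_line x w).
  have zw : tens2 z w = - a *: tens2 z x + b *: tens2 z y.
    have xz : tens2 x z = - tens2 z x.
      rewrite -{1}xy_z /tens2 tens_brr /= lie_brxx tens0l subr0.
      by rewrite lie_brC xy_z tensNl.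
    have yz : tens2 y z = - tens2 z y.
      by rewrite -{1}xy_z /tens2 tens_brr /= lie_brxx tens0l sub0r xy_z.
    rewrite -{1}xy_z /tens2 tens_brl /= yw xw !tensZr.
    rewrite -/(tens2 x z) -/(tens2 y z).
    by rewrite xz yz scaleNr !scalerN opprK.
  rewrite /= !inE => /or4P[/eqP-> // | /eqP-> // | /eqP-> | Tv].
    by rewrite -/(tens2 z w) zw; apply: lin_closedD => //; apply: lin_closedZ.
  by apply: PT; rewrite !inE Tv !orbT.
have [d dimd le_d] := triple_tensor_dim adnil spanT span_s.
exists d => //; apply: leq_ltn_trans le_d _.
rewrite size_s subn1.
have -> : size T = (n * n.-1).-1.
  rewrite /T; set A := flatten _.
  rewrite [LHS]/= size_cat size_map [size A]size_allpairs size_s.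
  have -> : size s' = n.-1.-2.-1 by rewrite -size_s.
  by case: (n) n_gt3 => [|[|[|[|k]]]].
by case: (n) n_gt3 => [|[|k]] // _; rewrite -mulnn mulnA ltn_pmul2r // mulSn.
Qed.

Lemma heisenberg_isom : \dim (fullv : {vspace L}) = 3%N ->
  lie_isom L (heisenberg F).
Proof.
move=> dim3; pose X := [tuple y; x; z].
have freeX : free X := derived_line_free.
have basX : basis_of fullv X by rewrite basisEfree freeX subvf dim3.
(* As y comes first in X, the coordinates along x and y, c0 and c1, are those of
   index 1 and 0. *)
pose c0 := coord X (lift ord0 ord0); pose c1 := coord X ord0.
pose c2 := coord X (lift ord0 (lift ord0 ord0)).
have lE l : l = c0 l *: x + c1 l *: y + c2 l *: z.
  rewrite {1}(coord_basis basX (memvf l)) !big_ord_recl big_ord0 addr0 /=.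
  by rewrite addrCA addrA.
pose f l : heisenberg F :=
  c0 l *: heis_x F + c1 l *: heis_y F + c2 l *: heis_z F.
pose h (u : heisenberg F) : L :=
  heis_crd 0 u *: x + heis_crd 1 u *: y + heis_crd 2 u *: z.
have f_lin : linear f.
  have c_lin i a u v : coord X i (a *: u + v) = a * coord X i u + coord X i v.
    exact: linearP.
  move=> a u v; rewrite /f /c0 /c1 /c2 !c_lin !scalerDl !scalerDr !scalerA.
  by rewrite [RHS](AC (3*3) ((1*4)*(2*5)*(3*6))).
have h_lin : linear h.
  move=> a u v; rewrite /h !heis_crd_is_linear !scalerDl !scalerDr !scalerA.
  by rewrite [RHS](AC (3*3) ((1*4)*(2*5)*(3*6))).
have fK : cancel f h.
  move=> l; rewrite /h /f; have [-> -> ->] := heis_crdE (c0 l) (c1 l) (c2 l).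
  by rewrite -lE.
have fx : f x = heis_x F.
  have Xx : x = X`_(lift ord0 ord0 : 'I_3) by [].
  by rewrite /f /c0 /c1 /c2 Xx !coord_free //= scale1r !scale0r !addr0.
have fy : f y = heis_y F.
  have Xy : y = X`_(ord0 : 'I_3) by [].
  by rewrite /f /c0 /c1 /c2 Xy !coord_free //= scale1r !scale0r add0r addr0.
have fz : f z = heis_z F.
  have Xz : z = X`_(lift ord0 (lift ord0 ord0) : 'I_3) by [].
  by rewrite /f /c0 /c1 /c2 Xz !coord_free //= scale1r !scale0r !add0r.
pose fL : {linear L -> heisenberg F} :=
  HB.pack f (GRing.isLinear.Build _ _ _ *:%R f f_lin).
have fD u v : f (u + v) = f u + f v := linearD fL u v.
have fZ a u : f (a *: u) = a *: f u := linearZ_LR fL a u.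
exists f; last first.
  exists h => // u.
  by rewrite /h !fD !fZ fx fy fz -heis_eta.
split=> // u v; rewrite {1}[u]lE {1}[v]lE.
rewrite (heisenberg_br _ _ _ _ _ _ xy_z) ?derived_line_central //.
rewrite fZ fz /f heisenberg_br //.
- exact: heis_brxy.
- exact: heis_brxz.
- exact: heis_bryz.
Qed.

End DerivedLine.
End UpperBound.

(** * The lower bound for the Heisenberg algebra *)

Section LowerBound.
Local Set Implicit Arguments.
Local Unset Strict Implicit.
Import GRing.Theory.
Local Open Scope ring_scope.
Variable F : fieldType.

(** [V] with zero bracket; Lie morphisms into it are the linear maps that kill
    brackets, which is all that is needed to separate tensors. *)
Definition trivial_lie (V : lmodType F) : Type := V.

HB.instance Definition _ (V : lmodType F) :=
  GRing.Lmodule.copy (trivial_lie V) V.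

Section TrivialLie.
Variable V : lmodType F.
Let br (u v : trivial_lie V) : trivial_lie V := 0.
Let brDl x y z : br (x + y) z = br x z + br y z. Proof. by rewrite addr0. Qed.
Let brDr x y z : br x (y + z) = br x y + br x z. Proof. by rewrite addr0. Qed.
Let brZl a x y : br (a *: x) y = a *: br x y. Proof. by rewrite scaler0. Qed.
Let brZr a x y : br x (a *: y) = a *: br x y. Proof. by rewrite scaler0. Qed.
Let brxx x : br x x = 0. Proof. by []. Qed.
Let brJ x y z : br x (br y z) + br y (br z x) + br z (br x y) = 0.
Proof. by rewrite !addr0. Qed.
HB.instance Definition _ := Lmodule_isLie.Build F (trivial_lie V)
  brDl brDr brZl brZr brxx brJ.
End TrivialLie.

(** The universal property of the non-abelian tensor product, for abelian
    targets: there the bracket relation reduces to the last hypothesis. *)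
Lemma lie_tensor_lift (L K : lieAlgType F) (f : lie_action L K)
    (g : lie_action K L) (fg : lie_compatible f g) (V : lmodType F)
    (B : L -> K -> V) :
    (forall k, linear (B^~ k)) -> (forall l, linear (B l)) ->
    (forall l l' k, B [< l, l' >] k = B l (f l' k) - B l' (f l k)) ->
    (forall l k k', B l [< k, k' >] = B (g k' l) k - B (g k l) k') ->
    (forall l k l' k', B (g k l) (f l' k') = 0) ->
  exists h : lie_tensor fg -> V,
    [/\ linear h, forall l k, h (tens fg l k) = B l k
      & forall u v, h [< u, v >] = 0].
Proof.
move=> Bl Br Bbrl Bbrr Bbr.
pose b (p : L * K) : trivial_lie V := B p.1 p.2.
have Bl0 k : B 0 k = 0.
  by have := Bl k (-1) 0 0; rewrite scaler0 addr0 scaleN1r addNr.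
have Br0 l : B l 0 = 0.
  by have := Br l (-1) 0 0; rewrite scaler0 addr0 scaleN1r addNr.
have b_rel s t : tensor_rel f g s t -> lie_eval b s = lie_eval b t.
  case=> [c l k|c l k|l l' k|l k k'|l l' k|l k k'|l k l' k'] /=; rewrite /b /=.
  - by have := Bl k c l 0; rewrite Bl0 !addr0.
  - by have := Br l c k 0; rewrite Br0 !addr0.
  - by have := Bl k 1 l l'; rewrite !scale1r.
  - by have := Br l 1 k k'; rewrite !scale1r.
  - exact: Bbrl.
  - exact: Bbrr.
  - by rewrite Bbr oppr0.
have [h_lin h_br] := lie_lift_hom b_rel.
exists (lie_lift (R := tensor_rel f g) b); split=> //.
by move=> l k; apply: (lie_lift_gen b_rel).
Qed.

Section Heisenberg.
Variables (L : lieAlgType F) (f : L -> heisenberg F).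
Hypotheses (f_hom : lie_hom f) (f_bij : bijective f).

Let al l : F := heis_crd 0 (f l).
Let be l : F := heis_crd 1 (f l).
Let ga l : F := heis_crd 2 (f l).

Let alP a u v : al (a *: u + v) = a * al u + al v.
Proof. by rewrite /al f_hom.1 heis_crd_is_linear. Qed.
Let beP a u v : be (a *: u + v) = a * be u + be v.
Proof. by rewrite /be f_hom.1 heis_crd_is_linear. Qed.
Let gaP a u v : ga (a *: u + v) = a * ga u + ga v.
Proof. by rewrite /ga f_hom.1 heis_crd_is_linear. Qed.

Let crd_br u v :
  [/\ al [< u, v >] = 0, be [< u, v >] = 0
    & ga [< u, v >] = al u * be v - be u * al v].
Proof.
rewrite /al /be /ga f_hom.2 [f u]heis_eta [f v]heis_eta.
rewrite (heisenberg_br _ _ _ _ _ _ (heis_brxy F) (heis_brxz F) (heis_bryz F)).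
set c := _ - _; have [] := heis_crdE 0 0 c.
by rewrite !scale0r !add0r => -> -> ->; split=> //; rewrite -!heis_eta.
Qed.
Let al_br u v : al [< u, v >] = 0. Proof. by case: (crd_br u v). Qed.
Let be_br u v : be [< u, v >] = 0. Proof. by case: (crd_br u v). Qed.
Let ga_br u v : ga [< u, v >] = al u * be v - be u * al v.
Proof. by case: (crd_br u v). Qed.
Let crdE := (alP, beP, gaP, al_br, be_br, ga_br).

Let row6 (s : seq F) : 'rV[F]_6 := \row_i s`_i.

Let row6P (u v : 'rV[F]_6) :
  (forall i, (i < 6)%N -> u 0 (inord i) = v 0 (inord i)) -> u = v.
Proof. by move=> uv; apply/rowP=> i; rewrite -[i]inord_val; apply: uv. Qed.

(** In the tensor square of H(1), [z (x) x = - x (x) z], [z (x) y = - y (x) z]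
    and [z (x) z = 0]; the six coordinates are the coefficients of [x (x) x],
    [x (x) y], [y (x) x], [y (x) y], [x (x) z] and [y (x) z]. *)
Lemma heisenberg_square_map :
  exists phi : tensor_square L -> 'rV[F]_6,
    [/\ linear phi, forall a b, phi (tens2 a b) =
          row6 [:: al a * al b; al a * be b; be a * al b; be a * be b;
                   al a * ga b - ga a * al b; be a * ga b - ga a * be b]
      & forall u v, phi [< u, v >] = 0].
Proof.
apply: lie_tensor_lift => /=.
- move=> k c u v; apply: row6P => i i6; rewrite !mxE !inordK // !crdE.
  by case: i i6 => [|[|[|[|[|[|//]]]]]] _ /=; ring.
- move=> k c u v; apply: row6P => i i6; rewrite !mxE !inordK // !crdE.
  by case: i i6 => [|[|[|[|[|[|//]]]]]] _ /=; ring.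
- move=> l l' k; apply: row6P => i i6; rewrite !mxE !inordK // !crdE.
  by case: i i6 => [|[|[|[|[|[|//]]]]]] _ /=; ring.
- move=> l k k'; apply: row6P => i i6; rewrite !mxE !inordK // !crdE.
  by case: i i6 => [|[|[|[|[|[|//]]]]]] _ /=; ring.
move=> l k l' k'; apply: row6P => i i6; rewrite !mxE !inordK // !crdE.
by case: i i6 => [|[|[|[|[|[|//]]]]]] _ /=; ring.
Qed.

(** Write T for the tensor square and [x t] for the action of [x] on [t] in T.
    As the image of [lie_lambda] is central, T acts trivially on [L], and the
    only relation to respect, beyond bilinearity, is
    [t (x) z = (y t) (x) x - (x t) (x) y].  The two components of the map are
    the coefficients, in T, of [x] and of [y] after elimination of [z]. *)
Lemma heisenberg_triple_map :
  exists2 psi : triple_tensor L -> ('rV[F]_6 * 'rV[F]_6)%type,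
    linear psi & forall w, exists v, psi v = w.
Proof.
have [phi [phi_lin phi_tens phi_br]] := heisenberg_square_map.
have phi0 : phi 0 = 0.
  by have := phi_lin (-1) 0 0; rewrite scaler0 addr0 scaleN1r addNr.
have al_lam t : al (lie_lambda t) = 0 /\ be (lie_lambda t) = 0.
  elim/(@lie_tensor_lin_ind _ _ _ _ _ (lie_ad_compatible L)): t => [|a b].
    have al0 : al 0 = 0 by have := al_br 0 0; rewrite lie_br0l.
    have be0 : be 0 = 0 by have := be_br 0 0; rewrite lie_br0l.
    have lam0 : lie_lambda (0 : tensor_square L) = 0.
      by have := (lie_lambda_hom L).2 0 0; rewrite !lie_brxx.
    split=> [|a u v [au bu] [av bv]]; first by rewrite lam0.
    by rewrite (lie_lambda_hom L).1 alP beP au bu av bv mulr0 addr0.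
  by rewrite -/(tens2 a b) lie_lambda_tens al_br be_br.
(* An element k = a x + b y + c z acts on t through the coefficient
   D t of x (x) y - y (x) x alone: k t = D t (a x (x) z + b y (x) z). *)
pose D t := phi t 0 (inord 1) - phi t 0 (inord 2).
have D_lin a u v : D (a *: u + v) = a * D u + D v.
  by rewrite /D phi_lin !mxE; ring.
have phi_act k t :
    phi (square_lact L k t) = row6 [:: 0; 0; 0; 0; al k * D t; be k * D t].
  elim/(@lie_tensor_lin_ind _ _ _ _ _ (lie_ad_compatible L)): t => [|a b].
    split=> [|a u v IHu IHv].
      rewrite lact0 /D phi0.
      apply: row6P => i i6; rewrite !mxE !inordK // subrr !mulr0.
      by case: i i6 => [|[|[|[|[|[|//]]]]]].
    rewrite lactDr lactZr phi_lin IHu IHv D_lin.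
    apply: row6P => i i6; rewrite !mxE !inordK //.
    by case: i i6 => [|[|[|[|[|[|//]]]]]] _ /=; ring.
  rewrite -/(tens2 a b) square_lact_tens -[X in X + _]scale1r phi_lin /D.
  rewrite !phi_tens.
  apply: row6P => i i6; rewrite !mxE !inordK // !crdE.
  by case: i i6 => [|[|[|[|[|[|//]]]]]] _ /=; ring.
have D_act k t : D (square_lact L k t) = 0.
  by rewrite /D phi_act !mxE !inordK //= subrr.
pose B t l := (al l *: phi t + row6 [:: 0; 0; 0; 0; 0; ga l * D t],
               be l *: phi t - row6 [:: 0; 0; 0; 0; ga l * D t; 0]).
have pair6P (u v : 'rV[F]_6 * 'rV[F]_6) :
    (forall i, (i < 6)%N -> u.1 0 (inord i) = v.1 0 (inord i) /\
                            u.2 0 (inord i) = v.2 0 (inord i)) -> u = v.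
  case: u v => [u1 u2] [v1 v2] /= uv.
  by congr (_, _); apply: row6P => i /uv[].
have [psi [psi_lin psi_tens _]] :
    exists psi : triple_tensor L -> ('rV[F]_6 * 'rV[F]_6)%type,
      [/\ linear psi, forall t l, psi (tens (square_compatible L) t l) = B t l
        & forall u v, psi [< u, v >] = 0].
  apply: lie_tensor_lift.
  - move=> l a u v; apply: pair6P => i i6.
    rewrite /B /= phi_lin D_lin !mxE !inordK //.
    by case: i i6 => [|[|[|[|[|[|//]]]]]] _ /=; split; ring.
  - move=> t a u v; apply: pair6P => i i6; rewrite /B /= !mxE !inordK // !crdE.
    by case: i i6 => [|[|[|[|[|[|//]]]]]] _ /=; split; ring.
  - move=> t t' l; apply: pair6P => i i6.
    rewrite /B !square_ractE /D phi_br /= !mxE !inordK // !crdE.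
    rewrite !(al_lam _).1 !(al_lam _).2.
    by case: i i6 => [|[|[|[|[|[|//]]]]]] _ /=; split; ring.
  - move=> t k k'; apply: pair6P => i i6.
    rewrite /B /= !D_act !phi_act /= !mxE !inordK // !crdE /=.
    by case: i i6 => [|[|[|[|[|[|//]]]]]] _ /=; split; ring.
  move=> t k t' k'; apply: pair6P => i i6.
  rewrite /B !square_ractE /= !mxE !inordK // !crdE !(al_lam _).1 !(al_lam _).2.
  by case: i i6 => [|[|[|[|[|[|//]]]]]] _ /=; split; ring.
exists psi => // -[w1 w2].
have [h fK hK] := f_bij.
have crd_h a b c (v := h (a *: heis_x F + b *: heis_y F + c *: heis_z F)) :
    [/\ al v = a, be v = b & ga v = c].
  by rewrite /v /al /be /ga hK; apply: heis_crdE.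
have [ax bx gx] := crd_h 1 0 0; have [ay ey gy] := crd_h 0 1 0.
have [az bz gz] := crd_h 0 0 1.
set x := h _ in ax bx gx; set y := h _ in ay ey gy; set z := h _ in az bz gz.
have phi_surj (u : 'rV[F]_6) : exists t, phi t = u.
  pose u_ i := u 0 (inord i).
  exists (u_ 0%N *: tens2 x x + (u_ 1%N *: tens2 x y + (u_ 2%N *: tens2 y x +
    (u_ 3%N *: tens2 y y + (u_ 4%N *: tens2 x z +
    (u_ 5%N *: tens2 y z + 0)))))).
  rewrite !phi_lin phi0 !phi_tens ax bx gx ay ey gy az bz gz.
  apply: row6P => i i6; rewrite !mxE !inordK //.
  by case: i i6 => [|[|[|[|[|[|//]]]]]] _ /=; rewrite -/(u_ _); ring.
have [[t1 t1w] [t2 t2w]] := (phi_surj w1, phi_surj w2).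
exists (1 *: tens (square_compatible L) t1 x + tens (square_compatible L) t2 y).
rewrite psi_lin !psi_tens /B t1w t2w ax bx gx ay ey gy.
apply: pair6P => i i6; rewrite /= !mxE !inordK //.
by case: i i6 => [|[|[|[|[|[|//]]]]]] _ /=; split; ring.
Qed.

End Heisenberg.
End LowerBound.

(** * The theorem *)

Section HeisenbergDim.
Import GRing.Theory.
Local Open Scope ring_scope.

Lemma lie_isom_dim (F : fieldType) (L M : vectLieAlgType F) :
  lie_isom L M -> dim L = dim M.
Proof.
move=> [f [f_lin _] [h fK hK]].
have h_lin : linear h by move=> a u v; apply: (can_inj fK); rewrite f_lin !hK.
apply/anti_leq/andP; split.
  by apply: (dim_surj h_lin) => l; exists (f l).
by apply: (dim_surj f_lin) => u; exists (h u).
Qed.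

Lemma triple_tensor_heisenberg_ge (F : fieldType) (L : lieAlgType F) d :
  lie_isom L (heisenberg F) -> has_dim (triple_tensor L) d -> (12 <= d)%N.
Proof.
move=> [f f_hom f_bij] dimd.
have [psi psi_lin psi_surj] := heisenberg_triple_map f_hom f_bij.
have := has_dim_surj dimd psi_lin psi_surj.
by rewrite [dim _](_ : _ = dim 'rV[F]_6 + dim 'rV[F]_6)%N // dim_rV.
Qed.

Lemma nonabelian_br (F : fieldType) (L : lieAlgType F) :
  ~ lie_abelian L -> exists x y : L, [< x, y >] != 0.
Proof.
move=> nabL; apply: contrapT => no_xy; apply: nabL => x y.
by apply: contrapT => /eqP xy; apply: no_xy; exists x, y.
Qed.

End HeisenbergDim.

Theorem theorem3p8 (F : fieldType) (L : vectLieAlgType F) (n m : nat)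
    (dimL : \dim (fullv : {vspace L}) = n)
    (nilL : lie_nilpotent L)
    (nabL : ~ lie_abelian L)
    (dimL' : \dim (lie_derived L) = m) :
  (exists2 d : nat, has_dim (triple_tensor L) d & d <= n * (n - m) ^ 2) /\
  (m = 1 ->
     (has_dim (triple_tensor L) (n * (n - 1) ^ 2) <->
      lie_isom L (heisenberg F))).
Proof.
subst n m; have [d dimd le_d] := triple_tensor_bound nilL.
split=> [|dimL']; first by exists d.
split=> [eq_dim | isoL].
  have [x [y xy_neq0]] := nonabelian_br _ _ nabL.
  have n_ge3 : 3 <= \dim (fullv : {vspace L}).
    have free_yxz := derived_line_free nilL dimL' erefl xy_neq0.
    by rewrite -[3](eqnP free_yxz) dimvS ?subvf.
  have [n_gt3 | n_le3] := ltnP 3 (\dim (fullv : {vspace L})).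
    have [d' dimd' lt_d'] :=
      triple_tensor_strict nilL dimL' erefl xy_neq0 n_gt3.
    by rewrite (has_dim_inj dimd' eq_dim) ltnn in lt_d'.
  apply: (heisenberg_isom nilL dimL' erefl xy_neq0).
  by apply/eqP; rewrite eqn_leq n_le3.
have dim3 : \dim (fullv : {vspace L}) = 3.
  by rewrite dimvf (lie_isom_dim _ _ _ isoL); apply: dim_rV.
rewrite dimL' dim3 in le_d *.
by rewrite (_ : 3 * (3 - 1) ^ 2 = d) //; apply/anti_leq; rewrite le_d
  (triple_tensor_heisenberg_ge _ _ _ isoL dimd).
Qed.
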